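(* Let $A,B$ be positive definite matrices and $-1\le t\le-\tfrac12$. Then \[ A\,\widehat{sp}_t\,B\prec_{\log}\left(A^{1-t}B^{2t}A^{1-t}\right)^{1/2}. \]
   Context: For positive definite matrices $A,B$ and $t\in\mathbb{R}$: $A\sharp B:=A^{1/2}(A^{-1/2}BA^{-1/2})^{1/2}A^{1/2}$ and $A\,\widehat{sp}_t\,B:=(A^{-1}\sharp B)^tA(A^{-1}\sharp B)^t$. For $n\times n$ positive semidefinite matrices $X,Y$ with eigenvalues $\lambda_1(\cdot)\ge\dots\ge\lambda_n(\cdot)$, $X\prec_{\log}Y$ means $\prod_{j=1}^k\lambda_j(X)\le\prod_{j=1}^k\lambda_j(Y)$ for $k=1,\dots,n-1$ and $\det X=\det Y$. *)

(* Defs.v *)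
(* matrices over the complex numbers R[i] (R : realType),
   spectral theory from mathcomp/algebra/spectral.v, real powers powR from
   mathcomp-analysis. *)
From HB Require Import structures.
From mathcomp Require Import all_boot all_order all_algebra.
From mathcomp Require Import sesquilinear spectral.
From mathcomp Require Import complex.
From mathcomp Require Import reals exp.
Set Implicit Arguments.
Unset Strict Implicit.
Unset Printing Implicit Defensive.
Import Order.TTheory GRing.Theory Num.Theory.
Local Open Scope ring_scope.
Local Open Scope sesquilinear_scope.

Section Defs.
Variable R : realType.
Local Notation C := (R[i]).

(* positive definite: Hermitian and x A x^* > 0 for every nonzero (row) vector x *)
Definition posdef n (A : 'M[C]_n) : Prop :=
  A \is hermsymmx /\ forall x : 'rV[C]_n, x != 0 -> 0 < (x *m A *m x ^t*) 0 0.

(* real power A^t of a positive definite matrix, by functional calculus on the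
   spectral decomposition A = P^-1 diag(d) P (P unitary) of the normal matrix A;
   the eigenvalues d_i are positive reals and are mapped to d_i^t. *)
Definition mxpow n (A : 'M[C]_n) (t : R) : 'M[C]_n :=
  invmx (spectralmx A)
  *m diag_mx (map_mx (fun z : C => ((powR (complex.Re z) t)%:C)%C) (spectral_diag A))
  *m spectralmx A.

(* geometric mean  A # B = A^{1/2} (A^{-1/2} B A^{-1/2})^{1/2} A^{1/2} *)
Definition gmean n (A B : 'M[C]_n) : 'M[C]_n :=
  mxpow A (1/2) *m mxpow (mxpow A (-(1/2)) *m B *m mxpow A (-(1/2))) (1/2)
  *m mxpow A (1/2).

(* A \widehat{sp}_t B = (A^{-1} # B)^t A (A^{-1} # B)^t *)
Definition spt n (A B : 'M[C]_n) (t : R) : 'M[C]_n :=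
  mxpow (gmean (invmx A) B) t *m A *m mxpow (gmean (invmx A) B) t.

(* eigenvalues (with algebraic multiplicity) = roots of the characteristic
   polynomial; for positive semidefinite matrices they are real, and we list
   their real parts in non-increasing order lambda_1 >= ... >= lambda_n. *)
Definition eigs n (X : 'M[C]_n) : seq R :=
  sort (fun x y : R => y <= x)
       [seq complex.Re z | z <- sval (closed_field_poly_normal (char_poly X))].

(* log-majorization X <_log Y *)
Definition logmaj n (X Y : 'M[C]_n) : Prop :=
  (forall k : nat, (1 <= k <= n - 1)%N ->
     \prod_(j < k) (eigs X)`_j <= \prod_(j < k) (eigs Y)`_j)
  /\ \det X = \det Y.

End Defs.

(* Main.v *)
(* Write [s = - t], [p = 2 s] in [[1, 2]], [G = A^-1 # B] and [H = G^-1]; then [G A G = B],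
   so [B^-1 = H A^-1 H].  Let [N] be the product of the [k] largest singular values.  The
   claim for [k] is [N (A^{1/2} H^s) ^ 2 <= N (A^{1+s} B^{-s})], and it follows from

     N (A^{1/2} H^s) <= N (A^{1/p} H) ^ s
                     <= N (A^{1/2+1/p} H A^{-1/2}) ^ s = N (A^{1/2+1/p} B^{-1/2}) ^ s
                     <= N (A^{1+s} B^{-s}) ^ {1/2}.

   All three inequalities are instances of one fact: [x |-> N (X^x S Y^x)] is log-convex.
   With [S = 1] this gives the Cordes-type first and last ones; with [Y = X^-1] and [S]
   Hermitian the function is moreover even, hence nondecreasing on [x >= 0], which is the
   middle one.  Log-convexity at midpoints combines Weyl's inequality (the [k] largest
   eigenvalues have product at most [N]) with the submultiplicativity of [N]; both come
   from maximising [det (V P V^* )] over [k]-frames [V], so no exterior powers are needed. *)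
Require Import Defs.
From HB Require Import structures.
From mathcomp Require Import all_boot all_order all_algebra all_fingroup.
From mathcomp Require Import sesquilinear spectral complex.
From mathcomp Require Import classical_sets reals exp.
From mathcomp Require Import ring lra.
Import Order.TTheory GRing.Theory Num.Theory.
Set Implicit Arguments.
Unset Strict Implicit.
Unset Printing Implicit Defensive.
Local Open Scope ring_scope.
Local Open Scope sesquilinear_scope.

(** * Minors: Cauchy-Binet with a diagonal weight *)

Lemma det_mulmx_diag (K : comNzRingType) k n (V : 'M[K]_(k, n)) (d : 'rV[K]_n)
    (W : 'M[K]_(n, k)) :
  \det (V *m diag_mx d *m W) =
  \sum_(f : {ffun 'I_k -> 'I_n})
    (\prod_i (V i (f i) * d 0 (f i))) * \det (rowsub f W).
Proof.
(* Leibniz expansion; the product over [i] of sums over [j] is then distributed into a sum over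
   index maps [f]. *)
pose VW (s : 'S_k) i j := V i j * d 0 j * W j (s i).
transitivity (\sum_(f : {ffun 'I_k -> 'I_n}) \sum_(s : 'S_k)
    (-1) ^+ s * \prod_i VW s i (f i)).
  rewrite exchange_big; apply: eq_bigr => /= s _; rewrite -big_distrr /=.
  congr (_ * _); rewrite -(bigA_distr_bigA (VW s)) /=.
  by apply: eq_bigr => i _; rewrite mxE; apply: eq_bigr => j _; rewrite mul_mx_diag mxE.
apply: eq_bigr => f _; rewrite mulr_sumr; apply: eq_bigr => s _.
rewrite mulrCA; congr (_ * _); rewrite -big_split /=.
by apply: eq_bigr => i _; rewrite mxE.
Qed.

(* Summing over all index maps rather than over subsets counts every minor [k`!] times. *)
Lemma Cauchy_Binet_diag (K : comNzRingType) k n (V : 'M[K]_(k, n)) (d : 'rV[K]_n)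
    (W : 'M[K]_(n, k)) :
  \det (V *m diag_mx d *m W) *+ k`! =
  \sum_(f : {ffun 'I_k -> 'I_n})
    (\prod_i d 0 (f i)) * (\det (colsub f V) * \det (rowsub f W)).
Proof.
(* Precomposing [f] with [s] permutes the rows of the minor of [W] and yields the sign of [s];
   adding up over all [s] assembles the minor of [V]. *)
have detf (s : 'S_k) : \det (V *m diag_mx d *m W) =
    \sum_(f : {ffun 'I_k -> 'I_n}) (\prod_i d 0 (f i)) *
      (((-1) ^+ s * \prod_i (colsub f V) i (s i)) * \det (rowsub f W)).
  rewrite det_mulmx_diag (reindex_inj (h := fun f : {ffun 'I_k -> 'I_n} => [ffun i => f (s i)])) /=.
    apply: eq_bigr => f _; rewrite big_split /=.
    rewrite [X in _ * X * _ = _](_ : _ = \prod_i d 0 (f i)); last first.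
      by rewrite [RHS](reindex_perm s); apply: eq_bigr => i _; rewrite ffunE.
    have -> : rowsub [ffun i => f (s i)] W = row_perm s (rowsub f W).
      by apply/matrixP => i j; rewrite !mxE ffunE.
    rewrite row_permE det_mulmx det_perm.
    have -> : \prod_i V i ([ffun i0 => f (s i0)] i) = \prod_i colsub f V i (s i).
      by apply: eq_bigr => i _; rewrite !mxE ffunE.
    by rewrite -!mulrA mulrCA; congr (_ * _); rewrite mulrCA.
  move=> f g /ffunP fg; apply/ffunP => i.
  by have := fg (s^-1 i)%g; rewrite !ffunE permKV.
have {1}-> : k`! = #|{perm 'I_k}| by rewrite -(card_Sn k); apply: eq_card.
rewrite -sumr_const.
under eq_bigr => s _ do rewrite (detf s).
rewrite exchange_big /=; apply: eq_bigr => f _.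
by rewrite -mulr_sumr -mulr_suml.
Qed.

(** By pigeonhole some value of [f] is at least the last index on the right, so its factor is at
    most the last one there; remove both and induct. *)
Lemma prod_inj_le (K : realDomainType) k n (d : nat -> K) (f : 'I_k -> 'I_n) :
    (forall i, 0 <= d i) -> {homo d : i j / (i <= j)%N >-> j <= i} ->
    injective f ->
  \prod_i d (f i) <= \prod_(j < k) d j.
Proof.
move=> d0 dh; elim: k f => [|k IHk] f finj; first by rewrite !big_ord0.
have [i0 fi0] : exists i0, (k <= f i0)%N.
  apply/existsP; rewrite -[[exists _, _]]negbK negb_exists; apply/negP => /forallP fk.
  have fk' i : (f i < k)%N by rewrite ltnNge fk.
  have : injective (fun i => Ordinal (fk' i)).
    by move=> i j [] /val_inj; apply: finj.
  by move/leq_card; rewrite !card_ord ltnn.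
rewrite (bigD1_ord i0) //= big_ord_recr /= mulrC.
apply: ler_pM; rewrite ?prodr_ge0 //; last exact: dh.
by apply: (IHk (fun i => f (lift i0 i))) => i j /finj /lift_inj.
Qed.

(** * Conjugate transposes, invertibility and similarity *)

Lemma trmxC_mul (C : numClosedFieldType) m n p (A : 'M[C]_(m, n)) (B : 'M[C]_(n, p)) :
  (A *m B) ^t* = B ^t* *m A ^t*.
Proof. by rewrite trmx_mul map_mxM. Qed.

Lemma trmxC_mul3 (C : numClosedFieldType) m n p q (A : 'M[C]_(m, n))
    (B : 'M[C]_(n, p)) (D : 'M[C]_(p, q)) :
  (A *m B *m D) ^t* = D ^t* *m B ^t* *m A ^t*.
Proof. by rewrite !trmxC_mul mulmxA. Qed.

Lemma trmxC_mul3_herm (C : numClosedFieldType) n (A B D : 'M[C]_n) :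
  A ^t* = A -> B ^t* = B -> D ^t* = D -> (A *m B *m D) ^t* = D *m B *m A.
Proof. by rewrite trmxC_mul3 => -> -> ->. Qed.

Lemma unitmx_mul3 (K : comUnitRingType) n (A B D : 'M[K]_n) :
  A \in unitmx -> B \in unitmx -> D \in unitmx -> A *m B *m D \in unitmx.
Proof. by rewrite !unitmx_mul => -> ->. Qed.

Lemma trmxC_unit (C : numClosedFieldType) n (A : 'M[C]_n) :
  (A ^t* \in unitmx) = (A \in unitmx).
Proof. by rewrite map_unitmx unitmx_tr. Qed.

Lemma det_trmxC (C : numClosedFieldType) n (A : 'M[C]_n) : \det (A ^t*) = (\det A)^*.
Proof. by rewrite det_map_mx det_tr. Qed.

Lemma hermsymmxP (C : numClosedFieldType) n (A : 'M[C]_n) :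
  reflect (A ^t* = A) (A \is hermsymmx).
Proof.
by apply: (iffP (is_hermitianmxP _ _ _)); rewrite expr0 scale1r => /esym.
Qed.

Lemma char_poly_conj (K : fieldType) n (Z X : 'M[K]_n) : Z \in unitmx ->
  char_poly (Z *m X *m invmx Z) = char_poly X.
Proof.
move=> Zu; have ZpK : map_mx polyC Z *m map_mx polyC (invmx Z) = 1%:M.
  by rewrite -map_mxM mulmxV // map_mx1.
rewrite /char_poly.
have -> : char_poly_mx (Z *m X *m invmx Z) =
    map_mx polyC Z *m char_poly_mx X *m map_mx polyC (invmx Z).
  rewrite /char_poly_mx mulmxBr mulmxBl !map_mxM; congr (_ - _).
  by rewrite mul_mx_scalar -scalemxAl ZpK scalemx1.
by rewrite !det_mulmx mulrAC -det_mulmx ZpK det1 mul1r.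
Qed.

Lemma unitary_trmxCK (C : numClosedFieldType) n (U : 'M[C]_n) :
  U \is unitarymx -> U ^t* *m U = 1%:M.
Proof. by move=> Uu; rewrite -invmx_unitary // mulVmx // unitarymx_unit. Qed.

Section PosDef.
Variable R : realType.
Local Notation C := R[i].
Implicit Types (n k : nat) (s t : R).

Lemma powR_prod (I : finType) (F : I -> R) t : (forall i, 0 <= F i) ->
  \prod_i (F i `^ t) = (\prod_i F i) `^ t.
Proof.
move=> F0; suff [] : \prod_i (F i `^ t) = (\prod_i F i) `^ t /\ 0 <= \prod_i F i by [].
elim/big_ind2: _ => [|x1 x2 y1 y2 [-> x0] [-> y0]|i _]; rewrite ?powR1 //.
by rewrite powRM // mulr_ge0.
Qed.

(** * Positive definite matrices: spectral form and real powers *)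

Definition rdiag n (d : 'I_n -> R) : 'M[C]_n := diag_mx (\row_i (d i)%:C%C).

Lemma eq_rdiag n (d e : 'I_n -> R) : d =1 e -> rdiag d = rdiag e.
Proof. by move=> de; congr diag_mx; apply/rowP => i; rewrite !mxE de. Qed.

Lemma rdiagM n (d e : 'I_n -> R) : rdiag d *m rdiag e = rdiag (fun i => d i * e i).
Proof.
rewrite /rdiag mulmx_diag; congr diag_mx; apply/rowP => i.
by rewrite !mxE rmorphM.
Qed.

Lemma rdiag1 n : rdiag (fun _ : 'I_n => 1) = 1%:M.
Proof.
rewrite -diag_const_mx; congr diag_mx; apply/rowP => i.
by rewrite !mxE rmorph1.
Qed.

Lemma det_rdiag n (d : 'I_n -> R) : \det (rdiag d) = (\prod_i d i)%:C%C.
Proof. by rewrite det_diag rmorph_prod; apply: eq_bigr => i _; rewrite mxE. Qed.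

Lemma rdiag_trmxC n (d : 'I_n -> R) : (rdiag d) ^t* = rdiag d.
Proof.
rewrite /rdiag tr_diag_mx map_diag_mx; congr diag_mx; apply/rowP => i.
by rewrite !mxE; apply/CrealP/complex_realP; exists (d i).
Qed.

Lemma posdef_rdiag n (d : 'I_n -> R) : (forall i, 0 < d i) -> posdef (rdiag d).
Proof.
move=> d0; split; first by apply/hermsymmxP; rewrite rdiag_trmxC.
move=> x x0; rewrite mul_mx_diag mxE.
have xdx i : (\matrix_(i, j) (x i j * (\row_i (d i)%:C%C) 0 j)) 0 i * x^t* i 0
    = (d i)%:C%C * (x 0 i * (x 0 i)^*).
  by rewrite !mxE mulrA [x 0 i * _]mulrC.
under eq_bigr do rewrite xdx.
have [i xi] : exists i, x 0 i != 0 by apply/rV0Pn.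
have ge0 j : 0 <= (d j)%:C%C * (x 0 j * (x 0 j)^*).
  by rewrite mulr_ge0 ?mul_conjC_ge0 // ler0c ltW.
rewrite (bigD1 i) //= ltr_wpDr ?sumr_ge0 //.
by rewrite mulr_gt0 ?mul_conjC_gt0 // ltcR.
Qed.

Lemma posdef_congr n (P X : 'M[C]_n) :
  posdef P -> X \in unitmx -> posdef (X *m P *m X ^t*).
Proof.
move=> [/hermsymmxP Ph P0] Xu; split.
  by apply/hermsymmxP; rewrite !trmxC_mul trmxCK Ph mulmxA.
move=> x x0; have := P0 (x *m X); rewrite trmxC_mul !mulmxA; apply.
by apply: contra x0 => /eqP xX; rewrite -(mulmxK Xu x) xX mul0mx.
Qed.

Lemma posdef_spectral n (A : 'M[C]_n) : posdef A ->
  exists (U : 'M[C]_n) (d : 'I_n -> R),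
    [/\ U \is unitarymx, forall i, 0 < d i & A = U ^t* *m rdiag d *m U].
Proof.
move=> [Ah A0]; have /hermitian_normalmx /orthomx_spectralP := Ah.
set U := spectralmx A; set D := spectral_diag A => AE.
have Uu : U \is unitarymx := spectral_unitarymx A.
(* [D 0 i] is the value of the quadratic form of [A] at the [i]-th row of [U]. *)
have D0 i : 0 < D 0 i.
  have xi0 : row i U != 0.
    apply/eqP => Ui; have /matrixP/(_ i i) := unitarymxP Uu.
    rewrite mxE big1 => [|j _].
      by rewrite !mxE eqxx => /esym/eqP; rewrite oner_eq0.
    by have /rowP/(_ j) := Ui; rewrite !mxE => ->; rewrite mul0r.
  have := A0 _ xi0; rewrite AE !mulmxA -[row i U *m _]row_mul (mulmxV (unitarymx_unit Uu)).
  rewrite -mulmxA row1 -rowE mxE.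
  have -> : U *m (row i U)^t* = col i 1%:M.
    rewrite -(unitarymxP Uu); apply/colP => j; rewrite !mxE.
    by apply: eq_bigr => l _; rewrite !mxE.
  rewrite (bigD1 i) //= big1 => [|j /negPf ji].
    by rewrite !mxE eqxx mulr1 addr0 mulr1n.
  by rewrite !mxE ji mulr0.
exists U, (fun i => complex.Re (D 0 i)); split=> // [i|].
  by have := D0 i; rewrite ltcE /= => /andP[].
transitivity (U ^t* *m diag_mx D *m U); first by rewrite -(invmx_unitary Uu).
suff -> : rdiag (fun i => complex.Re (D 0 i)) = diag_mx D by [].
congr diag_mx; apply/rowP => i.
by rewrite mxE RRe_real // gtr0_real.
Qed.

Lemma posdef_conj_rdiag n (U : 'M[C]_n) (d : 'I_n -> R) :
  U \is unitarymx -> (forall i, 0 < d i) -> posdef (U ^t* *m rdiag d *m U).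
Proof.
move=> Uu d0; rewrite -{2}[U]trmxCK; apply: posdef_congr; first exact: posdef_rdiag.
by rewrite trmxC_unit unitarymx_unit.
Qed.

(* [D W = W D'] entrywise says that [W i j != 0] forces equal eigenvalues, so the same
   intertwining relation holds after applying a function to both diagonals. *)
Lemma mxpowE n (U : 'M[C]_n) (d : 'I_n -> R) t :
    U \is unitarymx -> (forall i, 0 < d i) ->
  mxpow (U ^t* *m rdiag d *m U) t = U ^t* *m rdiag (fun i => d i `^ t) *m U.
Proof.
move=> Uu d0; set A := _ *m _ *m U.
have [/hermitian_normalmx/orthomx_spectralP AE _] := posdef_conj_rdiag Uu d0.
rewrite -/A in AE; rewrite /mxpow.
move: AE (spectral_unit A); move: (spectralmx A) (spectral_diag A) => Q D AE Qu.
have DW : diag_mx D *m (Q *m U^t*) = (Q *m U^t*) *m rdiag d.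
  have := congr1 (fun X => Q *m X *m U^t*) AE; rewrite {1}/A !mulmxA (mulmxV Qu) mul1mx.
  by rewrite -[_ *m U *m _]mulmxA (unitarymxP Uu) mulmx1 => <-.
set fD := diag_mx _; have fDW : fD *m (Q *m U^t*) = (Q *m U^t*) *m rdiag (fun i => d i `^ t).
  apply/matrixP => i j; have /matrixP/(_ i j) := DW.
  rewrite /fD !mul_diag_mx !mul_mx_diag; move: (Q *m _) => W; rewrite !mxE.
  have [->|Wij] := eqVneq (W i j) 0; first by rewrite !mulr0 !mul0r.
  by rewrite [W i j * _]mulrC => /(mulIf Wij) ->; rewrite mulrC.
rewrite -[LHS]mulmx1 -(unitary_trmxCK Uu).
have -> : invmx Q *m fD *m Q *m (U^t* *m U) = invmx Q *m (fD *m (Q *m U^t*)) *m U.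
  by rewrite !mulmxA.
by rewrite fDW !mulmxA (mulVmx Qu) mul1mx.
Qed.

Lemma eq_conj_rdiag n (U : 'M[C]_n) (d e : 'I_n -> R) : d =1 e ->
  U ^t* *m rdiag d *m U = U ^t* *m rdiag e *m U.
Proof. by move=> /eq_rdiag ->. Qed.

Lemma conj_rdiagM n (U : 'M[C]_n) (d e : 'I_n -> R) : U \is unitarymx ->
  (U ^t* *m rdiag d *m U) *m (U ^t* *m rdiag e *m U) =
  U ^t* *m rdiag (fun i => d i * e i) *m U.
Proof.
move=> Uu; rewrite -rdiagM !mulmxA -[_ *m U *m _]mulmxA (unitarymxP Uu).
by rewrite mulmx1.
Qed.

Lemma det_conj_rdiag n (U : 'M[C]_n) (d : 'I_n -> R) : U \is unitarymx ->
  \det (U ^t* *m rdiag d *m U) = (\prod_i d i)%:C%C.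
Proof.
move=> Uu; rewrite !det_mulmx det_rdiag mulrAC -det_mulmx (unitary_trmxCK Uu).
by rewrite det1 mul1r.
Qed.

Lemma posdef_unit n (A : 'M[C]_n) : posdef A -> A \in unitmx.
Proof.
move=> /posdef_spectral[U [d [Uu d0 ->]]].
rewrite unitmxE (det_conj_rdiag _ Uu) unitfE.
rewrite -(rmorph0 (real_complex R)) (inj_eq (@complexI _)).
by rewrite gt_eqF // prodr_gt0.
Qed.

Lemma posdef_trmxC n (A : 'M[C]_n) : posdef A -> A ^t* = A.
Proof. by case=> /hermsymmxP. Qed.

Lemma posdef1 n : posdef (1%:M : 'M[C]_n).
Proof. by rewrite -rdiag1; apply: posdef_rdiag. Qed.

Lemma posdef_mul_trmxC n (X : 'M[C]_n) : X \in unitmx -> posdef (X *m X ^t*).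
Proof.
by move=> Xu; rewrite -[X in X *m _]mulmx1; apply: posdef_congr => //; apply: posdef1.
Qed.

Lemma mxpow_posdef n (A : 'M[C]_n) t : posdef A -> posdef (mxpow A t).
Proof.
move=> /posdef_spectral[U [d [Uu d0 ->]]]; rewrite (mxpowE _ Uu d0).
by apply: posdef_conj_rdiag => // i; rewrite powR_gt0.
Qed.

Lemma mxpow_unit n (A : 'M[C]_n) t : posdef A -> mxpow A t \in unitmx.
Proof. by move=> /(mxpow_posdef t)/posdef_unit. Qed.

Lemma mxpow_trmxC n (A : 'M[C]_n) t : posdef A -> (mxpow A t) ^t* = mxpow A t.
Proof. by move=> /(mxpow_posdef t)/posdef_trmxC. Qed.

Lemma mxpowD n (A : 'M[C]_n) s t : posdef A ->
  mxpow A s *m mxpow A t = mxpow A (s + t).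
Proof.
move=> /posdef_spectral[U [d [Uu d0 ->]]]; rewrite !(mxpowE _ Uu d0).
rewrite (conj_rdiagM _ _ Uu); apply: eq_conj_rdiag => i.
by rewrite powRD // (gt_eqF (d0 i)) implybT.
Qed.

Lemma mxpow_mulE n (A : 'M[C]_n) s t (u : R) : posdef A -> s + t = u ->
  mxpow A s *m mxpow A t = mxpow A u.
Proof. by move=> A0 <-; exact: mxpowD. Qed.

Lemma mxpow0 n (A : 'M[C]_n) : posdef A -> mxpow A 0 = 1%:M.
Proof.
move=> /posdef_spectral[U [d [Uu d0 ->]]]; rewrite (mxpowE _ Uu d0).
rewrite (eq_rdiag (e := fun=> 1)) => [|i]; last by rewrite powRr0.
by rewrite rdiag1 mulmx1 (unitary_trmxCK Uu).
Qed.

Lemma mxpow1 n (A : 'M[C]_n) : posdef A -> mxpow A 1 = A.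
Proof.
move=> /posdef_spectral[U [d [Uu d0 ->]]]; rewrite (mxpowE _ Uu d0).
by apply: eq_conj_rdiag => i; rewrite powRr1 // ltW.
Qed.

Lemma mxpowM n (A : 'M[C]_n) s t : posdef A -> mxpow (mxpow A s) t = mxpow A (s * t).
Proof.
move=> /posdef_spectral[U [d [Uu d0 ->]]].
rewrite [mxpow (_ *m _) s](mxpowE _ Uu d0) (mxpowE (s * t) Uu d0).
rewrite (mxpowE _ Uu) => [|i]; last by rewrite powR_gt0.
by apply: eq_conj_rdiag => i; rewrite powRrM.
Qed.

Lemma mxpowNr n (A : 'M[C]_n) t : posdef A -> mxpow A (- t) *m mxpow A t = 1%:M.
Proof. by move=> A0; rewrite mxpowD // addNr mxpow0. Qed.

Lemma mxpowrN n (A : 'M[C]_n) t : posdef A -> mxpow A t *m mxpow A (- t) = 1%:M.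
Proof. by move=> A0; rewrite mxpowD // subrr mxpow0. Qed.

Lemma mxpowN n (A : 'M[C]_n) t : posdef A -> mxpow A (- t) = invmx (mxpow A t).
Proof.
move=> A0; rewrite -[LHS]mulmx1 -(mulmxV (mxpow_unit t A0)) mulmxA.
by rewrite (mxpowNr t A0) mul1mx.
Qed.

Lemma mxpowN1 n (A : 'M[C]_n) : posdef A -> mxpow A (- 1) = invmx A.
Proof. by move=> A0; rewrite mxpowN // mxpow1. Qed.

Lemma posdef_inv n (A : 'M[C]_n) : posdef A -> posdef (invmx A).
Proof. by move=> A0; rewrite -mxpowN1 //; apply: mxpow_posdef. Qed.

Lemma det_posdef n (A : 'M[C]_n) : posdef A -> exists2 a : R, 0 < a & \det A = a%:C%C.
Proof.
move=> /posdef_spectral[U [d [Uu d0 ->]]]; exists (\prod_i d i).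
  by rewrite prodr_gt0.
exact: det_conj_rdiag.
Qed.

Lemma det_mxpow n (A : 'M[C]_n) (a : R) t : posdef A -> \det A = a%:C%C ->
  \det (mxpow A t) = (a `^ t)%:C%C.
Proof.
move=> /posdef_spectral[U [d [Uu d0 ->]]]; rewrite (mxpowE _ Uu d0).
rewrite !det_conj_rdiag // => /complexI <-; congr (_%:C)%C.
by apply: powR_prod => i; apply: ltW.
Qed.

(** * Sorted eigenvalue lists of positive definite matrices *)

Lemma eigs_conj n (Z X : 'M[C]_n) : Z \in unitmx -> eigs (Z *m X *m invmx Z) = eigs X.
Proof. by move=> Zu; rewrite /eigs char_poly_conj. Qed.

Lemma eigs_mulC n (X Y : 'M[C]_n) : X \in unitmx -> eigs (X *m Y) = eigs (Y *m X).
Proof.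
move=> Xu; rewrite -[in RHS](eigs_conj _ Xu); congr eigs.
by rewrite !mulmxA mulmxK.
Qed.

Lemma eigs_conj_rdiag n (U : 'M[C]_n) (d : 'I_n -> R) : U \is unitarymx ->
  perm_eq (eigs (U ^t* *m rdiag d *m U)) (codom d).
Proof.
move=> Uu; have Uu' := unitarymx_unit Uu.
have -> : eigs (U ^t* *m rdiag d *m U) = eigs (rdiag d).
  rewrite -(eigs_conj _ Uu'); congr eigs.
  by rewrite !mulmxA (unitarymxP Uu) mul1mx mulmxK.
rewrite /eigs; case: closed_field_poly_normal => r /= rE.
rewrite perm_sort.
(* [r] is an unspecified list of roots; unique factorization into linear factors fixes it up to
   order. *)
have rp : perm_eq r [seq (d i)%:C%C | i <- enum 'I_n].
  apply: prod_XsubC_eq; have := rE.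
  rewrite (monicP (char_poly_monic _)) scale1r => <-.
  rewrite char_poly_trig ?diag_mx_is_trig // big_map big_enum.
  by apply: eq_bigr => i _; rewrite !mxE eqxx mulr1n.
have := perm_map (@complex.Re R) rp; rewrite -map_comp.
by rewrite (@eq_map _ _ _ d).
Qed.

Lemma eigs_sorted n (X : 'M[C]_n) : sorted (fun x y : R => y <= x) (eigs X).
Proof. by apply: sort_sorted => x y; apply: le_total. Qed.

Lemma size_eigs n (P : 'M[C]_n) : posdef P -> size (eigs P) = n.
Proof.
move=> /posdef_spectral[U [d [Uu d0 ->]]].
by rewrite (perm_size (eigs_conj_rdiag d Uu)) size_codom card_ord.
Qed.

Lemma mem_eigs_gt0 n (P : 'M[C]_n) : posdef P -> {in eigs P, forall x, 0 < x}.
Proof.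
move=> /posdef_spectral[U [d [Uu d0 ->]]] x.
by rewrite (perm_mem (eigs_conj_rdiag d Uu)) => /codomP[i ->].
Qed.

Lemma nth_eigs_gt0 n (P : 'M[C]_n) (i : nat) : posdef P -> (i < n)%N -> 0 < (eigs P)`_i.
Proof. by move=> P0 i_n; apply: (mem_eigs_gt0 P0); rewrite mem_nth // size_eigs. Qed.

Lemma nth_eigs_ge0 n (P : 'M[C]_n) (i : nat) : posdef P -> 0 <= (eigs P)`_i.
Proof.
move=> P0; have [i_n|n_i] := ltnP i n; first exact/ltW/nth_eigs_gt0.
by rewrite nth_default // size_eigs.
Qed.

(** Valid at all indices: past [n] the list reads as the default 0, which is below every
    eigenvalue. *)
Lemma nth_eigs_homo n (P : 'M[C]_n) : posdef P ->
  {homo nth 0 (eigs P) : i j / (i <= j)%N >-> j <= i}.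
Proof.
move=> P0 i j ij; have [j_n|n_j] := ltnP j n; last first.
  by rewrite [X in X <= _]nth_default ?size_eigs // nth_eigs_ge0.
apply: (sorted_leq_nth _ _ 0 (eigs_sorted P)) => //.
- by move=> y x z yx zy; apply: le_trans yx.
- by rewrite inE size_eigs // (leq_ltn_trans ij).
- by rewrite inE size_eigs.
Qed.

(** Permuting the rows of the unitary factor puts the eigenvalues into sorted order. *)
Lemma posdef_spectral_eigs n (P : 'M[C]_n) : posdef P ->
  exists2 U : 'M[C]_n, U \is unitarymx &
    P = U ^t* *m rdiag (fun i : 'I_n => (eigs P)`_i) *m U.
Proof.
move=> P0; have [U [d [Uu d0 PE]]] := posdef_spectral P0.
have /tuple_permP[p eE] : perm_eq (eigs P) [tuple d i | i < n].
  by rewrite {1}PE /= -/(codom d); apply: eigs_conj_rdiag.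
have eEi (i : 'I_n) : (eigs P)`_i = d (p i).
  by rewrite eE -[_`_i](tnth_nth 0 [tuple _ | i < n]) !tnth_mktuple.
exists (row_perm p U).
  apply/unitarymxP; apply/matrixP => i j.
  have /matrixP/(_ (p i) (p j)) := unitarymxP Uu.
  rewrite !mxE (inj_eq perm_inj) => <-.
  by apply: eq_bigr => l _; rewrite !mxE.
rewrite {1}PE !mul_mx_diag; apply/matrixP => i j; rewrite !mxE.
rewrite (reindex_perm p); apply: eq_bigr => l _.
by rewrite !mxE eEi.
Qed.

(** For [0 <= t] the power map keeps the order, so both lists are sorted; they are permutations of
    each other, hence equal. *)
Lemma nth_eigs_mxpow n (P : 'M[C]_n) t (i : 'I_n) : posdef P -> 0 <= t ->
  (eigs (mxpow P t))`_i = (eigs P)`_i `^ t.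
Proof.
move=> P0 t0; have [U Uu PE] := posdef_spectral_eigs P0.
have d0 (j : 'I_n) : 0 < (eigs P)`_j by apply: nth_eigs_gt0.
pose e (j : 'I_n) := (eigs P)`_j `^ t.
suff -> : eigs (mxpow P t) = codom e.
  by rewrite (nth_map i) ?size_enum_ord // /e nth_ord_enum.
have eh : {homo e : i j / (i <= j)%N >-> j <= i}.
  by move=> j l jl; apply: ge0_ler_powR => //; rewrite ?nnegrE ?nth_eigs_ge0 // nth_eigs_homo.
apply: (@sorted_eq _ (fun x y : R => y <= x)).
- by move=> y x z yx zy; apply: le_trans yx.
- by move=> x y /le_anti.
- exact: eigs_sorted.
- apply/(sortedP 0) => j; rewrite size_codom card_ord => jn.
  have jn' := ltnW jn.
  rewrite !(nth_map i) -?enumT ?size_enum_ord //.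
  by apply: eh; rewrite !nth_enum_ord.
- by rewrite {1}PE (mxpowE _ Uu d0); apply: eigs_conj_rdiag.
Qed.

(** * Products of the largest eigenvalues and squared singular values *)

Definition eigprod k n (X : 'M[C]_n) : R := \prod_(j < k) (eigs X)`_j.

(* The square of the product of the [k] largest singular values of [X]. *)
Definition svprod k n (X : 'M[C]_n) : R := eigprod k (X *m X ^t*).

Lemma eigprod_ge0 k n (P : 'M[C]_n) : posdef P -> 0 <= eigprod k P.
Proof. by move=> P0; apply: prodr_ge0 => j _; apply: nth_eigs_ge0. Qed.

Lemma eigprod_gt0 k n (P : 'M[C]_n) : (k <= n)%N -> posdef P -> 0 < eigprod k P.
Proof.
move=> kn P0; apply: prodr_gt0 => j _; apply: nth_eigs_gt0 => //.
exact: leq_trans kn.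
Qed.

Lemma eigprod_mxpow k n (P : 'M[C]_n) t : (k <= n)%N -> posdef P -> 0 <= t ->
  eigprod k (mxpow P t) = eigprod k P `^ t.
Proof.
move=> kn P0 t0; rewrite /eigprod -powR_prod => [|j]; last exact: nth_eigs_ge0.
by apply: eq_bigr => j _; apply: (nth_eigs_mxpow (widen_ord kn j) P0 t0).
Qed.

(** In an eigenbasis of [P], Cauchy-Binet writes both determinants as sums of squared moduli of
    minors, weighted on the left by products of [k] eigenvalues. Non-injective index maps give zero
    minors; for the others [prod_inj_le] bounds the weight. [V] is arbitrary because [svprod_mulmx]
    applies the bound to [V *m X]. *)
Lemma det_compress_le k n (P : 'M[C]_n) (V : 'M[C]_(k, n)) : posdef P ->
  \det (V *m P *m V ^t*) <= (eigprod k P)%:C%C * \det (V *m V ^t*).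
Proof.
move=> P0; have [U Uu PE] := posdef_spectral_eigs P0.
set e := fun _ => _ in PE; pose W := V *m U ^t*.
have -> : V *m P *m V ^t* = W *m rdiag e *m W ^t*.
  by rewrite {1}PE /W trmxC_mul trmxCK !mulmxA.
have -> : V *m V ^t* = W *m rdiag (fun=> 1) *m W ^t*.
  rewrite rdiag1 mulmx1 /W trmxC_mul trmxCK !mulmxA -[_ *m U]mulmxA.
  by rewrite (unitary_trmxCK Uu) mulmx1.
rewrite -(ler_pMn2r (fact_gt0 k)) -mulrnAr !Cauchy_Binet_diag mulr_sumr.
apply: ler_sum => f _.
rewrite [X in _ <= _ * (X * _)](_ : _ = 1) ?mul1r; last first.
  by rewrite big1 // => i _; rewrite mxE rmorph1.
have -> : rowsub f (W ^t*) = (colsub f W)^t* by apply/matrixP => i j; rewrite !mxE.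
rewrite det_trmxC; have [finj|] := boolP (injectiveb f); last first.
  case/injectivePn => i [j ij fij].
  suff -> : \det (colsub f W) = 0 by rewrite mul0r !mulr0.
  by rewrite -det_tr (determinant_alternate ij) // => l; rewrite !mxE fij.
apply: ler_wpM2r; first exact: mul_conjC_ge0.
have -> : \prod_i (\row_i (e i)%:C%C) 0 (f i) = (\prod_i e (f i))%:C%C.
  by rewrite rmorph_prod; apply: eq_bigr => i _; rewrite mxE.
rewrite lecR; apply: (prod_inj_le (d := nth 0 (eigs P))) => [i||].
- exact: nth_eigs_ge0.
- exact: nth_eigs_homo.
- exact/injectiveP.
Qed.

(** This frame attains equality in [det_compress_le], and its row space is invariant under [P]. *)
Lemma top_eigenvectors k n (P : 'M[C]_n) : (k <= n)%N -> posdef P ->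
  exists2 V : 'M[C]_(k, n), V *m V ^t* = 1%:M &
    V *m P = rdiag (fun j : 'I_k => (eigs P)`_j) *m V.
Proof.
move=> kn P0; have [U Uu PE] := posdef_spectral_eigs P0.
exists (rowsub (widen_ord kn) U).
  apply/matrixP => i j; have := unitarymxP Uu.
  move=> /matrixP/(_ (widen_ord kn i) (widen_ord kn j)); rewrite !mxE => <-.
  by apply: eq_bigr => l _; rewrite !mxE.
have UP : U *m P = rdiag (fun i : 'I_n => (eigs P)`_i) *m U.
  by rewrite {1}PE 2!mulmxA (unitarymxP Uu) mul1mx.
apply/matrixP => i j; have /matrixP/(_ (widen_ord kn i) j) := UP.
rewrite /rdiag !mul_diag_mx !mxE => <-.
by apply: eq_bigr => l _; rewrite !mxE.
Qed.

Lemma posdef_compress k n (P : 'M[C]_n) (V : 'M[C]_(k, n)) :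
  posdef P -> V *m V ^t* = 1%:M -> posdef (V *m P *m V ^t*).
Proof.
move=> [/hermsymmxP Ph P0] VV; split.
  by apply/hermsymmxP; rewrite !trmxC_mul trmxCK Ph mulmxA.
move=> x x0; have := P0 (x *m V); rewrite trmxC_mul !mulmxA; apply.
by apply: contra x0 => /eqP xV; rewrite -[x]mulmx1 -VV mulmxA xV mul0mx.
Qed.

Lemma svprod_gt0 k n (X : 'M[C]_n) : (k <= n)%N -> X \in unitmx -> 0 < svprod k X.
Proof. by move=> kn /posdef_mul_trmxC; apply: eigprod_gt0. Qed.

Lemma svprod_trmxC k n (X : 'M[C]_n) : X \in unitmx -> svprod k (X ^t*) = svprod k X.
Proof. by move=> Xu; rewrite /svprod /eigprod trmxCK eigs_mulC ?trmxC_unit. Qed.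

(** Take for [V] the top eigenvectors of [X Y] times its adjoint. Compressing [Y Y^*] by [V X], and
    then [X X^*] by [V], produces the two factors. *)
Lemma svprod_mulmx k n (X Y : 'M[C]_n) : (k <= n)%N ->
  X \in unitmx -> Y \in unitmx -> svprod k (X *m Y) <= svprod k X * svprod k Y.
Proof.
move=> kn Xu Yu; have XX0 := posdef_mul_trmxC Xu; have YY0 := posdef_mul_trmxC Yu.
have P0 : posdef ((X *m Y) *m (X *m Y) ^t*).
  by apply: posdef_mul_trmxC; rewrite unitmx_mul Xu.
have [V VV VP] := top_eigenvectors kn P0.
have detE : (svprod k (X *m Y))%:C%C = \det ((V *m X) *m (Y *m Y ^t*) *m (V *m X) ^t*).
  rewrite trmxC_mul !mulmxA -(det_rdiag (fun j : 'I_k => (eigs _)`_j)).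
  rewrite -[rdiag _]mulmx1 -[in LHS]VV [in LHS]mulmxA -VP.
  by rewrite trmxC_mul !mulmxA.
rewrite -lecR rmorphM mulrC [leLHS]detE.
apply: le_trans (det_compress_le _ YY0) _.
apply: ler_wpM2l; first by rewrite ler0c eigprod_ge0.
rewrite trmxC_mul !mulmxA -[V *m X *m _]mulmxA.
by apply: le_trans (det_compress_le _ XX0) _; rewrite VV det1 mulr1.
Qed.

(* Weyl: the row space of the top eigenvectors of [X] is [X]-invariant, so compressing
   [X X^*] to it has determinant the square of the product of the top eigenvalues. *)
Lemma eigprod_sqr_le_svprod k n (P X Z : 'M[C]_n) : (k <= n)%N ->
    posdef P -> Z \in unitmx -> X \in unitmx -> X = Z *m P *m invmx Z ->
  eigprod k P ^+ 2 <= svprod k X.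
Proof.
move=> kn P0 Zu Xu XE; have [V VV VP] := top_eigenvectors kn P0.
set D := rdiag _ in VP; pose W := V *m invmx Z.
have WX : W *m X = D *m W.
  by rewrite XE /W !mulmxA (mulmxKV Zu) VP.
have Zi : invmx Z \in unitmx by rewrite unitmx_inv.
(* This determinant is positive and cancels from both sides at the end. *)
have [w w0 wE] := det_posdef (posdef_compress (posdef_mul_trmxC Zi) VV).
have {}wE : \det (W *m W ^t*) = w%:C%C by rewrite -wE /W trmxC_mul !mulmxA.
have := det_compress_le W (posdef_mul_trmxC Xu); rewrite -/(svprod k X) wE.
have -> : W *m (X *m X ^t*) *m W ^t* = D *m (W *m W ^t*) *m D.
  rewrite !mulmxA WX -!mulmxA -trmxC_mul WX trmxC_mul rdiag_trmxC.
  by rewrite !mulmxA.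
have detD : \det D = (eigprod k P)%:C%C by exact: det_rdiag.
rewrite 2!det_mulmx wE detD; move: (eigprod k P) (svprod k X) => x y.
by rewrite -!rmorphM lecR mulrAC -expr2 ler_pM2r.
Qed.

(** * Log-convexity of [svprod] along real powers *)

Lemma svprod_interpolation k n (Z Xa Xb Xc S Ya Yb Yc : 'M[C]_n) : (k <= n)%N ->
    Z \in unitmx -> S \in unitmx -> Xa \in unitmx -> Xb \in unitmx -> Xc \in unitmx ->
    Ya \in unitmx -> Yb \in unitmx -> Yc \in unitmx ->
    Xb ^t* = Xb -> Xc ^t* = Xc -> Yb ^t* = Yb -> Yc ^t* = Yc ->
    Z *m Xc = Xa -> Xc *m invmx Z = Xb -> Yc *m Yc = Ya *m Yb ->
  svprod k (Xc *m S *m Yc) ^+ 2 <= svprod k (Xa *m S *m Ya) * svprod k (Xb *m S *m Yb).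
Proof.
move=> kn Zu Su Xau Xbu Xcu Yau Ybu Ycu Xbt Xct Ybt Yct XaE XbE YE.
have Tau := unitmx_mul3 Xau Su Yau; have Tbu := unitmx_mul3 Xbu Su Ybu.
have Tcu := unitmx_mul3 Xcu Su Ycu.
rewrite -(svprod_trmxC k Tbu).
have Tbu' : (Xb *m S *m Yb) ^t* \in unitmx by rewrite trmxC_unit; exact: Tbu.
(* With [T = Xc S Yc], conjugating [T T^*] by [Z] gives [Xa S Ya Yb S^* Xb], the product of
   [Xa S Ya] and the adjoint of [Xb S Yb]. Weyl bounds [svprod k T ^+ 2] by its [svprod], and
   submultiplicativity splits that. *)
apply: le_trans (svprod_mulmx kn Tau Tbu').
apply: (eigprod_sqr_le_svprod kn (posdef_mul_trmxC Tcu) Zu); first by rewrite unitmx_mul Tau.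
rewrite !trmxC_mul Xbt Xct Ybt Yct -XaE -XbE !mulmxA -[_ *m Ya *m Yb]mulmxA -YE.
by rewrite !mulmxA.
Qed.

Lemma svprod_midpoint k n (X Y S : 'M[C]_n) (a b : R) : (k <= n)%N ->
    posdef X -> posdef Y -> S \in unitmx ->
  svprod k (mxpow X ((a + b) / 2) *m S *m mxpow Y ((a + b) / 2)) ^+ 2 <=
  svprod k (mxpow X a *m S *m mxpow Y a) * svprod k (mxpow X b *m S *m mxpow Y b).
Proof.
move=> kn X0 Y0 Su; set c := (a + b) / 2.
(* [Z] is [X] to the power [a - c]: then [Z X^c = X^a], and [X^c Z^-1 = X^b] because
   [2 c = a + b]. *)
apply: (svprod_interpolation kn (mxpow_unit (a - c) X0) Su (mxpow_unit a X0)
  (mxpow_unit b X0) (mxpow_unit c X0) (mxpow_unit a Y0) (mxpow_unit b Y0)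
  (mxpow_unit c Y0) (mxpow_trmxC b X0) (mxpow_trmxC c X0) (mxpow_trmxC b Y0)
  (mxpow_trmxC c Y0)).
- by apply: (mxpow_mulE X0); rewrite subrK.
- by rewrite -(mxpowN _ X0); apply: (mxpow_mulE X0); rewrite /c; field.
- transitivity (mxpow Y (a + b)); last exact: (esym (mxpowD a b Y0)).
  by apply: (mxpow_mulE Y0); rewrite /c; field.
Qed.

(* At an inner point, [g] is controlled by an endpoint and another point: [g x ^+ 2 <= M]
   for [M := sup g], hence [M ^+ 2 <= M]. *)
Lemma midpoint_logconvex_le1 (g : R -> R) (a b K : R) :
    (forall x, a <= x <= b -> 0 <= g x <= K) ->
    (forall x y, a <= x <= b -> a <= y <= b -> g ((x + y) / 2) ^+ 2 <= g x * g y) ->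
    g a <= 1 -> g b <= 1 ->
  forall x, a <= x <= b -> g x <= 1.
Proof.
move=> gK gconv ga gb x0 x0ab; rewrite leNgt; apply/negP => gx0.
pose E := [set y | exists2 x, a <= x <= b & y = g x]%classic.
have Esup : has_sup E.
  split; first by exists (g x0), x0.
  by exists K => y [x xab ->]; have /andP[] := gK _ xab.
have gM x : a <= x <= b -> g x <= sup E.
  by move=> xab; apply: (sup_upper_bound Esup); exists x.
have gM2 x : a <= x <= b -> g x ^+ 2 <= sup E.
  move=> /andP[ax xb]; have ab : a <= b by apply: le_trans xb.
  have [xm|xm] := lerP x ((a + b) / 2).
    have yab : a <= 2 * x - a <= b by apply/andP; split; lra.
    have aab : a <= a <= b by rewrite lexx.
    have := gconv _ _ aab yab; have -> : (a + (2 * x - a)) / 2 = x by field.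
    move=> /le_trans; apply; apply: le_trans (gM _ yab).
    by have /andP[gy _] := gK _ yab; apply: ler_piMl.
  have yab : a <= 2 * x - b <= b by apply/andP; split; lra.
  have bab : a <= b <= b by rewrite lexx ab.
  have := gconv _ _ bab yab; have -> : (b + (2 * x - b)) / 2 = x by field.
  move=> /le_trans; apply; apply: le_trans (gM _ yab).
  by have /andP[gy _] := gK _ yab; apply: ler_piMl.
have M1 : 1 < sup E by apply: lt_le_trans (gM _ x0ab).
(* With [M = sup E], a value above [M - (M - 1) / 2 = (M + 1) / 2] has square above [M], since [((M
   + 1) / 2) ^+ 2 - M = ((M - 1) / 2) ^+ 2]. *)
have e0 : 0 < (sup E - 1) / 2 by lra.
have [_ [x xab ->] Mx] := sup_adherent e0 Esup.
by have := gM2 _ xab; nra.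
Qed.

(** The power is monotone in the exponent, in a direction that depends on whether [1 <= d]; the sum
    covers both cases. *)
Lemma powR_bounded (d x r : R) : 0 < d -> `|x| <= r -> d `^ x <= d `^ r + d `^ (- r).
Proof.
move=> d0; rewrite ler_norml => /andP[rx xr].
have [d1|d1] := lerP 1 d.
  by apply: le_trans (ler_powR d1 xr) _; rewrite lerDl powR_ge0.
apply: le_trans (_ : d `^ (- r) <= _); last by rewrite lerDr powR_ge0.
by apply: ger_powR => //; rewrite d0 ltW.
Qed.

(** Dividing by the log-affine function on the right keeps midpoint log-convexity and reduces to the
    bound 1; local boundedness of [f] takes the place of continuity. *)
Lemma midpoint_logconvex_interp (f : R -> R) (m c a b K : R) : 0 < m -> 0 < c ->
    (forall x, `|x| <= `|a| + `|b| -> f x <= K) ->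
    (forall x y, f ((x + y) / 2) ^+ 2 <= f x * f y) -> (forall x, 0 < f x) ->
    f a <= m * c `^ a -> f b <= m * c `^ b ->
  forall x, a <= x <= b -> f x <= m * c `^ x.
Proof.
move=> m0 c0 KE mid pos fa fb x xab.
have mc0 y : 0 < m * c `^ y by rewrite mulr_gt0 // powR_gt0.
pose r := `|a| + `|b|.
suff : f x / (m * c `^ x) <= 1 by rewrite ler_pdivrMr // mul1r.
apply: (@midpoint_logconvex_le1 (fun y => f y / (m * c `^ y)) a b
  (K * (m^-1 * (c `^ r + c `^ (- r))))) => //; last 2 first.
- by rewrite ler_pdivrMr // mul1r.
- by rewrite ler_pdivrMr // mul1r.
- move=> y yab; rewrite divr_ge0 ?(ltW (mc0 _)) ?(ltW (pos _)) //=.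
  have yr : `|y| <= r.
    by rewrite /r; case/andP: yab; case: (ler0P a); case: (ler0P b); rewrite ler_norml; lra.
  apply: ler_pM; rewrite ?invr_ge0 ?(ltW (mc0 _)) ?(ltW (pos _)) //; first exact: KE.
  rewrite invfM; apply: ler_wpM2l; first by rewrite invr_ge0 ltW.
  by rewrite -powRN; apply: powR_bounded => //; rewrite normrN.
- move=> y z _ _ /=.
  have -> : f y / (m * c `^ y) * (f z / (m * c `^ z)) =
      f y * f z / (m * c `^ ((y + z) / 2)) ^+ 2.
    rewrite mulf_div; congr (_ / _); rewrite expr2 mulrACA [RHS]mulrACA; congr (_ * _).
    by rewrite -!powRD ?(gt_eqF c0) ?implybT //; congr (_ `^ _); field.
  by rewrite expr_div_n ler_pM2r ?mid // invr_gt0 exprn_gt0.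
Qed.

Lemma eigprod_mxpow_bounded k n (P : 'M[C]_n) (r : R) : posdef P ->
  exists K : R, forall x, `|x| <= r -> eigprod k (mxpow P x) <= K.
Proof.
move=> P0; have [U [d [Uu d0 PE]]] := posdef_spectral P0.
(* Summing over all eigenvalues gives one bound for every factor; indices past [n] read as 0. *)
pose K := \sum_i (d i `^ r + d i `^ (- r)); exists (K ^+ k) => x xr.
have F0 i : 0 <= d i `^ r + d i `^ (- r) by rewrite addr_ge0 // powR_ge0.
have Px0 := mxpow_posdef x P0.
have -> : K ^+ k = \prod_(j < k) K by rewrite prodr_const card_ord.
apply: ler_prod => j _; rewrite (nth_eigs_ge0 _ Px0) /=.
have [jn|nj] := ltnP j n; last by rewrite nth_default ?sumr_ge0 // (size_eigs Px0).
have : (eigs (mxpow P x))`_j \in eigs (mxpow P x) by rewrite mem_nth // (size_eigs Px0).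
have -> : mxpow P x = U ^t* *m rdiag (fun i => d i `^ x) *m U.
  by rewrite {1}PE (mxpowE _ Uu d0).
move: ((eigs _)`_j) => y; rewrite (perm_mem (eigs_conj_rdiag _ Uu)) => /codomP[i ->].
apply: le_trans (powR_bounded (d0 i) xr) _.
by rewrite /K (bigD1 i) //= lerDl sumr_ge0.
Qed.

Lemma svprod_mxpow k n (P : 'M[C]_n) t : posdef P ->
  svprod k (mxpow P t) = eigprod k (mxpow P (t + t)).
Proof. by move=> P0; rewrite /svprod (mxpow_trmxC _ P0) (mxpowD _ _ P0). Qed.

Lemma svprod_bounded k n (X Y S : 'M[C]_n) (r : R) : (k <= n)%N ->
    posdef X -> posdef Y -> S \in unitmx ->
  exists K : R, forall x, `|x| <= r -> svprod k (mxpow X x *m S *m mxpow Y x) <= K.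
Proof.
move=> kn X0 Y0 Su.
(* The radius doubles because [svprod] of a power is [eigprod] of the power with twice the
   exponent. *)
have [K1 K1E] := eigprod_mxpow_bounded k (2 * r) X0.
have [K2 K2E] := eigprod_mxpow_bounded k (2 * r) Y0.
exists (K1 * svprod k S * K2) => x xr.
have xr2 : `|x + x| <= 2 * r by rewrite -mulr2n normrMn mulr2n; lra.
have Xu := mxpow_unit x X0; have Yu := mxpow_unit x Y0.
have XSu : mxpow X x *m S \in unitmx by rewrite unitmx_mul Xu.
have Xb := K1E _ xr2; have Yb := K2E _ xr2.
rewrite -(svprod_mxpow k x X0) in Xb; rewrite -(svprod_mxpow k x Y0) in Yb.
apply: le_trans (svprod_mulmx kn XSu Yu) _.
apply: ler_pM Yb; try exact/ltW/svprod_gt0.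
apply: le_trans (svprod_mulmx kn Xu Su) _.
by apply: ler_wpM2r Xb; apply/ltW/svprod_gt0.
Qed.

Lemma svprod_mxpow_interp k n (X Y S : 'M[C]_n) (m c a b : R) : (k <= n)%N ->
    posdef X -> posdef Y -> S \in unitmx -> 0 < m -> 0 < c ->
    svprod k (mxpow X a *m S *m mxpow Y a) <= m * c `^ a ->
    svprod k (mxpow X b *m S *m mxpow Y b) <= m * c `^ b ->
  forall x, a <= x <= b -> svprod k (mxpow X x *m S *m mxpow Y x) <= m * c `^ x.
Proof.
move=> kn X0 Y0 Su m0 c0.
have [K KE] := svprod_bounded (`|a| + `|b|) kn X0 Y0 Su.
have mid x y := svprod_midpoint x y kn X0 Y0 Su.
have pos x : 0 < svprod k (mxpow X x *m S *m mxpow Y x).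
  by apply: (svprod_gt0 kn); apply: (unitmx_mul3 _ Su); exact: mxpow_unit.
exact: (midpoint_logconvex_interp m0 c0 KE mid pos).
Qed.

(** * Cordes-type inequality and monotonicity under conjugation *)

Lemma svprod_mul_mxpow_le k n (X Y : 'M[C]_n) (x : R) : (k <= n)%N ->
    posdef X -> posdef Y -> 0 <= x <= 1 ->
  svprod k (mxpow X x *m mxpow Y x) <= svprod k (X *m Y) `^ x.
Proof.
move=> kn X0 Y0 x01.
have c0 : 0 < svprod k (X *m Y).
  by apply: (svprod_gt0 kn); rewrite unitmx_mul (posdef_unit X0); exact: posdef_unit.
have h0 : svprod k (mxpow X 0 *m 1%:M *m mxpow Y 0) <= 1 * svprod k (X *m Y) `^ 0.
  rewrite (mxpow0 X0) (mxpow0 Y0) powRr0 !mulmx1 mulr1 /svprod trmx1 map_mx1 mulmx1.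
  have I0 : posdef (1%:M : 'M[C]_n) by exact: posdef1.
  by rewrite -(mxpow0 I0) (eigprod_mxpow kn I0 (lexx 0)) powRr0 lexx.
have h1 : svprod k (mxpow X 1 *m 1%:M *m mxpow Y 1) <= 1 * svprod k (X *m Y) `^ 1.
  by rewrite (mxpow1 X0) (mxpow1 Y0) (powRr1 (ltW c0)) mulmx1 mul1r lexx.
(* Interpolation with [S = 1] between the exponent 0, where the value is 1, and the exponent 1. *)
have := svprod_mxpow_interp kn X0 Y0 (unitmx1 _ n) ltr01 c0 h0 h1 x01.
by rewrite mulmx1 mul1r => H; exact: H.
Qed.

(** As [S] is Hermitian, the adjoint exchanges the exponents [u] and [- u], so both ends of
    [[- u, u]] carry the same value; log-convexity keeps the values in between below it. *)
Lemma svprod_conj_mxpow_homo k n (A S : 'M[C]_n) (v u : R) : (k <= n)%N ->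
    posdef A -> posdef S -> 0 <= v <= u ->
  svprod k (mxpow A v *m S *m mxpow A (- v)) <=
  svprod k (mxpow A u *m S *m mxpow A (- u)).
Proof.
move=> kn A0 S0 /andP[v0 vu]; have Su := posdef_unit S0.
have pN (x : R) : mxpow (mxpow A (- 1)) x = mxpow A (- x).
  by rewrite (mxpowM _ _ A0) mulN1r.
have m0 : 0 < svprod k (mxpow A u *m S *m mxpow A (- u)).
  by apply: (svprod_gt0 kn); apply: (unitmx_mul3 _ Su); exact: mxpow_unit.
have Ai0 := mxpow_posdef (- 1) A0.
have vab : - u <= v <= u by rewrite vu andbT; lra.
have := svprod_mxpow_interp kn A0 Ai0 Su m0 ltr01 _ _ vab.
rewrite !powR1 !mulr1 !pN opprK; apply; last exact: lexx.
have uu := unitmx_mul3 (mxpow_unit u A0) Su (mxpow_unit (- u) A0).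
have uC := trmxC_mul3_herm (mxpow_trmxC u A0) (posdef_trmxC S0) (mxpow_trmxC (- u) A0).
have uE := etrans (congr1 (svprod k (n := n)) (esym uC)) (svprod_trmxC k uu).
by rewrite [leLHS]uE lexx.
Qed.

(** * The geometric mean and its Riccati equation *)

Lemma invmx_mul3 (K : comUnitRingType) n (X Y Z : 'M[K]_n) :
    X \in unitmx -> Y \in unitmx -> Z \in unitmx ->
  invmx (X *m Y *m Z) = invmx Z *m invmx Y *m invmx X.
Proof.
move=> Xu Yu Zu; have Tu := unitmx_mul3 Xu Yu Zu.
apply: (can_inj (mulKmx Tu)); rewrite mulmxV // !mulmxA.
by rewrite (mulmxK Zu) (mulmxK Yu) mulmxV.
Qed.

Lemma gmean_posdef n (A B : 'M[C]_n) : posdef A -> posdef B -> posdef (gmean A B).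
Proof.
have sandwich (t : R) (X Y : 'M[C]_n) :
    posdef X -> posdef Y -> posdef (mxpow X t *m Y *m mxpow X t).
  move=> X0 Y0; have := posdef_congr Y0 (mxpow_unit t X0).
  by rewrite (mxpow_trmxC t X0) => H; exact: H.
by move=> A0 B0; apply: (sandwich _ _ _ A0); apply: mxpow_posdef; exact: sandwich.
Qed.

Lemma gmean_Riccati n (A B : 'M[C]_n) : posdef A -> posdef B ->
  gmean A B *m invmx A *m gmean A B = B.
Proof.
move=> A0 B0; rewrite /gmean.
have M0 : posdef (mxpow A (- (1/2)) *m B *m mxpow A (- (1/2))).
  have := posdef_congr B0 (mxpow_unit (- (1/2)) A0).
  by rewrite (mxpow_trmxC _ A0) => H; exact: H.
have MM := mxpow_mulE M0 (_ : 1/2 + 1/2 = 1); rewrite (mxpow1 M0) in MM.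
have {}MM := MM ltac:(by field).
have aiA := mxpow_mulE A0 (_ : - (1/2) + - (1/2) = - 1); rewrite (mxpowN1 A0) in aiA.
have {}aiA := aiA ltac:(by field).
have aK := mxpowrN (1/2) A0; have Ka := mxpowNr (1/2) A0.
(* With [a] the square root of [A], [ai] its inverse and [M] the square root of [ai B ai], the
   product is [a M a ai ai a M a = a M M a = B]. *)
move: MM; move: (mxpow (_ *m B *m _) _) => M.
move: (mxpow A (1/2)) (mxpow A (- (1/2))) aiA aK Ka => a ai <- aK Ka MM.
rewrite !mulmxA -[_ *m a *m ai]mulmxA aK mulmx1 -[_ *m ai *m a]mulmxA Ka mulmx1.
by rewrite -[_ *m M *m M]mulmxA MM !mulmxA aK mul1mx -mulmxA Ka mulmx1.
Qed.

Lemma mulmx_sandwich (K : comUnitRingType) n (X V H W Y : 'M[K]_n) :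
  X *m (V *m H *m W) *m Y = (X *m V) *m H *m (W *m Y).
Proof. by rewrite !mulmxA. Qed.

Lemma mxpow_sandwich n (A H : 'M[C]_n) (x v y a b : R) : posdef A ->
    x + v = a -> v + y = b ->
  mxpow A x *m (mxpow A v *m H *m mxpow A v) *m mxpow A y = mxpow A a *m H *m mxpow A b.
Proof.
move=> A0 xv vy; apply: (etrans (mulmx_sandwich _ _ _ _ _)).
exact: (congr2 (fun X Y => X *m H *m Y) (mxpow_mulE A0 xv) (mxpow_mulE A0 vy)).
Qed.

(** The left product meets [H] and [Q] only through [H Q Q H], so [H Q] can be traded for [M]. It
    serves with [H = G^-1] and the inverse square roots [Q] of [A] and [M] of [B]. *)
Lemma mul_trmxC_eq n (W H Q M : 'M[C]_n) :
    W ^t* = W -> H ^t* = H -> Q ^t* = Q -> M ^t* = M -> H *m (Q *m Q) *m H = M *m M ->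
  (W *m H *m Q) *m (W *m H *m Q) ^t* = (W *m M) *m (W *m M) ^t*.
Proof.
move=> Wt Ht Qt Mt E; rewrite !trmxC_mul Wt Ht Qt Mt.
by rewrite !mulmxA -[in RHS](mulmxA W M) -E !mulmxA.
Qed.

Lemma powR_le_powR (x y q s r : R) : 0 <= x -> 0 <= s -> x <= y `^ q -> q * s = r ->
  x `^ s <= y `^ r.
Proof.
move=> x0 s0 xy <-; rewrite powRrM.
by apply: ge0_ler_powR => //; rewrite nnegrE ?powR_ge0.
Qed.

(** * The inequality chain and the determinant for a solution of the Riccati equation *)

Lemma svprod_Riccati k n (A B G : 'M[C]_n) t : (k <= n)%N ->
    posdef A -> posdef B -> posdef G -> G *m A *m G = B -> -1 <= t <= - (1/2) ->
  svprod k (mxpow A (1/2) *m mxpow G t) <=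
  svprod k (mxpow A (1 - t) *m mxpow B t) `^ (1/2).
Proof.
move=> kn A0 B0 G0 GAG /andP[t1 t2].
have t0 : t != 0 by apply/eqP; lra.
(* For [p = - 2 t], [q] is [1 / p] and lies in [[1/2, 1]]; [v] is its half, and [w = (1 - t) q]. *)
pose q := - (1 / (2 * t)); pose v := q / 2; pose w := q + 1/2.
have q01 : 0 <= q <= 1.
  rewrite /q; have -> : - (1 / (2 * t)) = 1 / (2 * - t) by field.
  by rewrite divr_ge0 ?ler_pdivrMr ?mul1r //; lra.
have v0 : 0 <= v by rewrite /v; lra.
have H0 := mxpow_posdef (- 1) G0; set H := mxpow G (- 1) in H0 *.
have s01 : 0 <= - t <= 1 by lra.
have le1 : svprod k (mxpow A (1/2) *m mxpow G t) <= svprod k (mxpow A q *m H) `^ (- t).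
  have := svprod_mul_mxpow_le kn (mxpow_posdef q A0) H0 s01.
  rewrite /H (mxpowM _ _ A0) (mxpowM _ _ G0) mulN1r opprK.
  have -> : q * - t = 1/2 by rewrite /q; field.
  by move=> h; exact: h.
(* For [S = A^v H A^v], conjugation by [A^v] gives [A^q H], and conjugation by [A^(v + 1/2)] gives
   [A^w H A^(- 1/2)]. *)
have le2 : svprod k (mxpow A q *m H) <= svprod k (mxpow A w *m H *m mxpow A (- (1/2))).
  have S0 := posdef_congr H0 (mxpow_unit v A0); rewrite (mxpow_trmxC v A0) in S0.
  have vu : 0 <= v <= v + 1/2 by rewrite v0; lra.
  have vq : v + v = q by rewrite /v; field.
  have vw : v + 1/2 + v = w by rewrite /w /v; field.
  have vv : v - (v + 1/2) = - (1/2) by ring.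
  have e0 := etrans (congr1 (mulmx (mxpow A q *m H)) (mxpow0 A0)) (mulmx1 _).
  have e1 := etrans (mxpow_sandwich H A0 vq (subrr v)) e0.
  have e2 := mxpow_sandwich H A0 vw vv.
  have h := svprod_conj_mxpow_homo kn A0 S0 vu.
  rewrite [leLHS](congr1 (svprod k (n := n)) e1) in h.
  rewrite [leRHS](congr1 (svprod k (n := n)) e2) in h.
  exact: h.
have le3 : svprod k (mxpow A w *m H *m mxpow A (- (1/2))) =
    svprod k (mxpow A w *m mxpow B (- (1/2))).
  have Mi : - (1/2) - 1/2 = - 1 :> R by field.
  have AA := etrans (mxpow_mulE A0 Mi) (mxpowN1 A0).
  have BB := etrans (mxpow_mulE B0 Mi) (mxpowN1 B0).
  (* This is the inverse of [G A G = B], with [A^-1] and [B^-1] split into square roots. *)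
  have HE : H *m (mxpow A (- (1/2)) *m mxpow A (- (1/2))) *m H =
      mxpow B (- (1/2)) *m mxpow B (- (1/2)).
    apply: (etrans (congr2 (fun X Y => X *m Y *m X) (mxpowN1 G0) AA)).
    apply: (etrans _ (esym BB)); rewrite -GAG.
    exact/esym/(invmx_mul3 (posdef_unit G0) (posdef_unit A0) (posdef_unit G0)).
  exact: (congr1 (eigprod k (n := n)) (mul_trmxC_eq (mxpow_trmxC w A0)
    (mxpow_trmxC (- 1) G0) (mxpow_trmxC (- (1/2)) A0) (mxpow_trmxC (- (1/2)) B0) HE)).
have le4 : svprod k (mxpow A w *m mxpow B (- (1/2))) <=
    svprod k (mxpow A (1 - t) *m mxpow B t) `^ q.
  have := svprod_mul_mxpow_le kn (mxpow_posdef (1 - t) A0) (mxpow_posdef t B0) q01.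
  rewrite (mxpowM _ _ A0) (mxpowM _ _ B0).
  have -> : (1 - t) * q = w by rewrite /w /q; field.
  have -> : t * q = - (1/2) by rewrite /q; field.
  by move=> h; exact: h.
have le5 := le_trans le2 (eq_ind_r (fun z => z <= _) le4 le3).
apply: le_trans le1 _.
have Au : mxpow A q *m H \in unitmx.
  rewrite unitmx_mul; apply/andP; split; [exact: mxpow_unit | exact: posdef_unit].
(* The exponents [q] and [- t] multiply to [1/2]. *)
apply: (powR_le_powR (ltW (svprod_gt0 kn Au)) _ le5); first by case/andP: s01.
by rewrite /q; field.
Qed.

Lemma sandwich_mul_trmxC n (X Y P : 'M[C]_n) : X ^t* = X -> Y ^t* = Y -> Y *m Y = P ->
  X *m P *m X = (X *m Y) *m (X *m Y) ^t*.
Proof. by move=> Xt Yt <-; rewrite trmxC_mul Xt Yt !mulmxA. Qed.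

(** With [a], [g] the determinants of [A], [G], the Riccati equation gives [det B = g a g], and both
    sides come to [a g^(2 t)]. *)
Lemma det_Riccati n (A B G : 'M[C]_n) t : posdef A -> posdef B -> posdef G ->
    G *m A *m G = B ->
  \det (mxpow G t *m A *m mxpow G t) =
  \det (mxpow (mxpow A (1 - t) *m mxpow B (2 * t) *m mxpow A (1 - t)) (1/2)).
Proof.
move=> A0 B0 G0 GAG.
have Q0 : posdef (mxpow A (1 - t) *m mxpow B (2 * t) *m mxpow A (1 - t)).
  have := posdef_congr (mxpow_posdef (2 * t) B0) (mxpow_unit (1 - t) A0).
  by rewrite (mxpow_trmxC (1 - t) A0) => h; exact: h.
have [a a0 aE] := det_posdef A0; have [g g0 gE] := det_posdef G0.
have bE : \det B = (g * a * g)%:C%C by rewrite -GAG !det_mulmx aE gE -!rmorphM.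
have det3 (X Y Z : 'M[C]_n) (x y z : R) : \det X = x%:C%C -> \det Y = y%:C%C ->
    \det Z = z%:C%C -> \det (X *m Y *m Z) = (x * y * z)%:C%C.
  by move=> hx hy hz; rewrite !det_mulmx hx hy hz -!rmorphM.
have GtE := det_mxpow t G0 gE; have AtE := det_mxpow (1 - t) A0 aE.
have BtE := det_mxpow (2 * t) B0 bE.
apply: (etrans (det3 _ _ _ _ _ _ GtE aE GtE)).
apply: (etrans _ (esym (det_mxpow (1/2) Q0 (det3 _ _ _ _ _ _ AtE BtE AtE)))).
have sqrE (y : R) : 0 < y -> (y * y) `^ (1/2) = y.
  move=> y0; rewrite powRM ?ltW // -powRD ?(gt_eqF y0) ?implybT //.
  by rewrite (_ : 1/2 + 1/2 = 1) ?powRr1 ?ltW //; field.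
(* The left side becomes the square root of its square, so that only the bases remain to be
   compared. *)
rewrite -[in LHS](sqrE (g `^ t * a * g `^ t)) ?mulr_gt0 ?powR_gt0 //.
congr ((_ `^ _)%:C)%C.
rewrite !powRM ?mulr_ge0 ?ltW // (_ : 2 * t = t + t); last by ring.
have aK : a `^ (1 - t) * a `^ t = a.
  by rewrite -powRD ?(gt_eqF a0) ?implybT // subrK powRr1 // ltW.
rewrite !(powRD (r := t) (s := t)) ?(gt_eqF a0) ?(gt_eqF g0) ?implybT //.
rewrite -[in LHS]aK; ring.
Qed.

End PosDef.

Theorem theorem4p7 (R : realType) (n : nat) (A B : 'M[R[i]]_n) (t : R) :
  posdef A -> posdef B -> -1 <= t <= -(1/2) ->
  logmaj (spt A B t)
         (mxpow (mxpow A (1 - t) *m mxpow B (2 * t) *m mxpow A (1 - t)) (1/2)).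
Proof.
move=> A0 B0 tI; rewrite /spt.
have Ai0 := posdef_inv A0.
have G0 := gmean_posdef Ai0 B0; have GAG := gmean_Riccati Ai0 B0.
(* [G] becomes an arbitrary positive definite solution of [G A G = B]. *)
rewrite invmxK in GAG; move: (gmean _ B) G0 GAG => G G0 GAG.
split; last exact: det_Riccati.
move=> k /andP[_ kn1]; have kn : (k <= n)%N := leq_trans kn1 (leq_subr 1 n).
have le := svprod_Riccati kn A0 B0 G0 GAG tI.
have half2 : 1/2 + 1/2 = 1 :> R by field.
have t2 : t + t = 2 * t by ring.
(* The left matrix, and the right one before its square root, take the form [X X^*], which turns
   [eigprod] into [svprod]. *)
have XE := sandwich_mul_trmxC (mxpow_trmxC t G0) (mxpow_trmxC (1/2) A0)
  (etrans (mxpow_mulE A0 half2) (mxpow1 A0)).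
have QE := sandwich_mul_trmxC (mxpow_trmxC (1 - t) A0) (mxpow_trmxC t B0)
  (mxpow_mulE B0 t2).
have Xu : mxpow A (1/2) *m mxpow G t \in unitmx.
  by rewrite unitmx_mul; apply/andP; split; exact: mxpow_unit.
have Yu : mxpow A (1 - t) *m mxpow B t \in unitmx.
  by rewrite unitmx_mul; apply/andP; split; exact: mxpow_unit.
have XC : (mxpow A (1/2) *m mxpow G t) ^t* = mxpow G t *m mxpow A (1/2).
  apply: (etrans (trmxC_mul _ _)).
  exact: (congr2 mulmx (mxpow_trmxC t G0) (mxpow_trmxC (1/2) A0)).
(* The factor found is [G^t A^(1/2)]; passing to its adjoint leaves [svprod] unchanged. *)
have lhsE : eigprod k (mxpow G t *m A *m mxpow G t) =
    svprod k (mxpow A (1/2) *m mxpow G t).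
  apply: (etrans _ (svprod_trmxC k Xu)).
  exact: (etrans (congr1 (eigprod k (n := n)) XE) (congr1 (svprod k (n := n)) (esym XC))).
have Q0 := posdef_mul_trmxC Yu.
have half0 : 0 <= 1/2 :> R by lra.
have rhsE : eigprod k (mxpow (mxpow A (1 - t) *m mxpow B (2 * t) *m mxpow A (1 - t)) (1/2)) =
    svprod k (mxpow A (1 - t) *m mxpow B t) `^ (1/2).
  apply: (etrans (congr1 (fun Q => eigprod k (mxpow Q (1/2))) QE)).
  exact: (eigprod_mxpow kn Q0 half0).
exact: (eq_ind_r (fun x => x <= _) (eq_ind_r (fun y => _ <= y) le rhsE) lhsE).
Qed.
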